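(* Let $p$ be a prime with $p \neq 2, 3$ and let $G$ be a finite $p$-group of coclass $r$ whose nilpotency class is strictly greater than $2$. Let $|\gamma_2 G| = p^k$. Then $$|\mathcal{M}(G)| \leq p^{\frac{r^2 - r}{2} + kr}.$$
   Context: For a finite $p$-group $G$ of order $p^n$ and nilpotency class $c$, the coclass of $G$ is $r := n - c$. $\gamma_2 G$ denotes the commutator subgroup of $G$. $\mathcal{M}(G)$ denotes the Schur multiplier of $G$, i.e. the second integral homology group $H_2(G,\mathbb{Z})$ with $G$ acting trivially on $\mathbb{Z}$. *)

(* Defs.v *)
From HB Require Import structures.
From mathcomp Require Import all_boot all_algebra all_fingroup all_solvable.
From mathcomp Require Import ring.
From mathcomp Require Import boolp classical_sets cardinality.

Set Implicit Arguments.
Unset Strict Implicit.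
Unset Printing Implicit Defensive.

Import GRing.Theory.
Local Open Scope ring_scope.

(* H_2(gT, Z) with trivial coefficients, from the inhomogeneous bar complex:
   the bar resolution of Z over Z[gT] tensored with the trivial module Z.
   Degree n is the free abelian group on gT ^ n. *)
Section BarComplex.

Variable gT : finGroupType.

Local Notation chain1 := {ffun gT -> int}.
Local Notation chain2 := {ffun gT * gT -> int}.
Local Notation chain3 := {ffun gT * gT * gT -> int}.

(* The bar symbols [g] and [g|h]. *)
Definition bar1 (g : gT) : chain1 := [ffun x => (x == g)%:Z].
Definition bar2 (g h : gT) : chain2 := [ffun x => (x == (g, h))%:Z].

Definition boundary2 (c : chain2) : chain1 :=
  \sum_(x : gT * gT) let: (g, h) := x in
    (bar1 h - bar1 (g * h)%g + bar1 g) *~ c x.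

Definition boundary3 (c : chain3) : chain2 :=
  \sum_(x : gT * gT * gT) let: (g, h, k) := x in
    (bar2 h k - bar2 (g * h)%g k + bar2 g (h * k)%g - bar2 g h) *~ c x.

Lemma boundary2_is_zmod_morphism : zmod_morphism boundary2.
Proof.
move=> a b; rewrite /boundary2 -sumrB; apply: eq_bigr => -[g h] _.
by rewrite !ffunE mulrzBr.
Qed.
HB.instance Definition _ :=
  GRing.isZmodMorphism.Build chain2 chain1 boundary2 boundary2_is_zmod_morphism.

Lemma boundary3_is_zmod_morphism : zmod_morphism boundary3.
Proof.
move=> a b; rewrite /boundary3 -sumrB; apply: eq_bigr => -[[g h] k] _.
by rewrite !ffunE mulrzBr.
Qed.
HB.instance Definition _ :=
  GRing.isZmodMorphism.Build chain3 chain2 boundary3 boundary3_is_zmod_morphism.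

Lemma boundary2_bar2 (g h : gT) :
  boundary2 (bar2 g h) = bar1 h - bar1 (g * h)%g + bar1 g.
Proof.
rewrite /boundary2 (bigD1 (g, h)) //= ffunE eqxx big1 ?addr0 // => -[g' h'] ne.
by rewrite ffunE (negbTE ne).
Qed.

Lemma boundary23 (c : chain3) : boundary2 (boundary3 c) = 0.
Proof.
rewrite /boundary3 raddf_sum big1 // => -[[g h] k] _.
rewrite raddfMz !(raddfB, raddfD) /= !boundary2_bar2 mulgA.
set a := bar1 k; set b := bar1 (h * k)%g; set d := bar1 h.
set e := bar1 (g * h * k)%g; set f := bar1 (g * h)%g; set l := bar1 g.
suff -> : a - b + d - (a - e + f) + (b - e + l) - (d - f + l) = 0 by rewrite mul0rz.
by apply/ffunP => x; rewrite !ffunE; ring.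
Qed.

Definition is_cycle2 : {pred chain2} := [pred c | boundary2 c == 0].

Lemma is_cycle2_zmod_closed : zmod_closed is_cycle2.
Proof.
split=> [|a b]; first by rewrite inE raddf0.
move=> /eqP a0 /eqP b0; apply/eqP.
by rewrite raddfB /= a0 b0 subr0.
Qed.
HB.instance Definition _ :=
  GRing.isZmodClosed.Build chain2 is_cycle2 is_cycle2_zmod_closed.

Record cycle2 := Cycle2 { cycle2_val :> chain2; _ : cycle2_val \in is_cycle2 }.
HB.instance Definition _ := [isSub for cycle2_val].
HB.instance Definition _ := [Choice of cycle2 by <:].
HB.instance Definition _ := [SubChoice_isSubZmodule of cycle2 by <:].

Definition is_boundary2 : {pred cycle2} :=
  [pred z : cycle2 | `[< exists c : chain3, boundary3 c = cycle2_val z >]].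

Lemma is_boundary2_zmod_closed : zmod_closed is_boundary2.
Proof.
split=> [|a b]; first by apply/asboolP; exists 0; rewrite raddf0.
move=> /asboolP[c cE] /asboolP[d dE]; apply/asboolP; exists (c - d).
by rewrite raddfB /=; move: cE dE => /= -> ->.
Qed.
HB.instance Definition _ :=
  GRing.isZmodClosed.Build cycle2 is_boundary2 is_boundary2_zmod_closed.

Definition homology2 := Quotient.quot is_boundary2.
HB.instance Definition _ := GRing.Zmodule.on homology2.

End BarComplex.

Definition schur_multiplier (gT : finGroupType) (G : {group gT}) : zmodType :=
  homology2 [subg G].

(* Meant for a p-group G: then #|G| = p ^ logn p #|G| and the class is at most
   this exponent, so the subtraction is not truncated. *)
Definition coclass (p : nat) (gT : finGroupType) (G : {group gT}) : nat :=
  (logn p #|G| - nil_class G)%N.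

(* Main.v *)
From HB Require Import structures.
Require Import Defs.
From mathcomp Require Import all_boot all_algebra all_fingroup all_solvable.
From mathcomp Require Import zify.

(** The Schur multiplier M of G is counted as a group of commutators.

    Let D = C_2 / (B_2 + |G| C_2), where C_2 and B_2 are the chains and the
    boundaries of degree 2 of the bar complex.  The symbols [g|h] form a
    2-cocycle with values in the finite group D, hence define a finite central
    extension E of G by D.  The abelianization of E evaluates boundaries of
    2-chains, so the class in D of a 2-cycle lies in [E, E]
    ([cycle2_in_der1]).  As |G| annihilates M ([card_cycle2_boundary]), a
    2-cycle that vanishes in D is a boundary ([bar_class_cycle_inj]).  Thus M
    embeds into the intersection of D and [E, E], whose order is
    |[E, E]| / |[G, G]|, and it remains to bound the order of [E, E]
    ([central_extension_bound]).

    Write g_i for the terms of the lower central series, p^m for the index of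
    [G, G] in G, and K_i = g_i(E) D, so that K_i / D = g_i(G).  As D is central,
    [K_i, E] = g_{i+1}(E).  Commutation is bilinear between successive
    quotients: g_2(E) / g_3(E) is an image of the exterior square of E / K_2,
    of order at most p^C(m,2) ([class2_der1_bound]), and g_{i+1}(E) / g_{i+2}(E)
    is an image of the tensor product of K_i / K_{i+1} and E / K_2, of order at
    most |K_i : K_{i+1}|^m ([card_commutator_bound]).  Multiplying these bounds,
    |[E, E]| <= p^(C(m,2) + k m).

    Let c be the class and p^n the order of G, so that r = n - c and m = n - k.
    If k >= c, then m <= r and the bound is good enough.  Otherwise k = c - 1,
    m = r + 1 and g_i(G) / g_{i+1}(G) has order p for 2 <= i <= c; then a factor
    p^(m-1) has to be saved.  The Jacobi identity confines g_3(E) / g_4(E) to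
    order p^2 instead of p^m ([class3_lcn3_bound]).  The last factor p comes from
    g_4(E) / g_5(E), where the commutator of w = [x, y] with itself gives the
    relation [w, x, y] = [w, y, x]; this relation is not void because the class
    of G is at least 3 ([class4_lcn4_bound]). *)

Set Implicit Arguments.
Unset Strict Implicit.
Unset Printing Implicit Defensive.

(** * Bounds on commutator subgroups *)

Section CommutatorBounds.
Local Open Scope group_scope.

(** When the commutators [u, x] commute with X, they depend multiplicatively on
    u: T is the image of a morphism whose kernel is the centraliser of x. *)
Lemma commutator_image (gT : finGroupType) (X Z : {group gT}) (x : gT) :
    {in X, forall u, [~ u, x] \in Z} -> Z \subset 'C(X) ->
  {T : {group gT} | [/\ T \subset Z, #|T| = #|X : 'C_X[x]|
                      & {in X, forall u, [~ u, x] \in T}]}.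
Proof.
move=> XxZ cXZ; pose f u := [~ u, x].
have fM : {in X &, {morph f : u v / u * v}}.
  move=> u v Xu Xv; rewrite /f commMgJ conjgE.
  by rewrite ((centsP cXZ) _ (XxZ u Xu) v Xv) mulKg.
pose phi := Morphism fM.
exists (phi @* X)%G; split.
- by apply/subsetP=> _ /morphimP[u _ Xu ->]; apply: XxZ.
- rewrite card_morphim /= setIid; congr #|_ : _|.
  apply/setP=> u; rewrite [RHS]in_setI; apply/idP/idP=> [kfu | /andP[Xu cxu]].
    have Xu : u \in X := dom_ker kfu.
    by rewrite Xu; apply/cent1P/commgP/eqP/(kerP phi Xu).
  by apply/(kerP phi Xu)/eqP/commgP/cent1P.
- by move=> u Xu; apply: (@mem_morphim _ _ _ phi).
Qed.

Lemma commg_joing_cycle (gT : finGroupType) (A L T : {group gT}) (x : gT) :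
    T \subset 'C(A <*> <[x]>) -> T \subset 'C(L) ->
    [~: A, L] \subset T -> {in L, forall u, [~ u, x] \in T} ->
  [~: A <*> <[x]>, L] \subset T.
Proof.
move=> cAxT cLT sALT LxT.
have nTAx : A <*> <[x]> \subset 'N(T) by rewrite cents_norm // centsC.
have /andP[nTA nTx] : (A \subset 'N(T)) && (<[x]> \subset 'N(T)).
  by rewrite -join_subG.
have nTL : L \subset 'N(T) by rewrite cents_norm // centsC.
rewrite -quotient_cents2 // quotientY // join_subG quotient_cents2r //=.
rewrite cycle_subG in nTx; rewrite quotient_cycle // cycle_subG.
apply/centP=> _ /morphimP[u Nu Lu ->].
by apply/esym/commgP; rewrite -morphR //=; apply/eqP/coset_id/LxT.
Qed.

(** The induction step for bounds that grow with the index of K in L: L is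
    obtained from a smaller group by adding a single element. *)
Lemma maximal_joing_cycle (gT : finGroupType) (K L : {group gT}) :
    K \subset L -> K != L ->
  exists (M : {group gT}) (x : gT),
    [/\ K \subset M, M \proper L, x \in L & M <*> <[x]> = L].
Proof.
move=> sKL neKL.
have prKL : K \proper L.
  by rewrite properEneq sKL andbT; apply: contraNneq neKL => /val_inj->.
have [M maxM sKM] :=
  @maxgroup_exists _ (fun M : {group gT} => M \proper L) K prKL.
have /andP[sML /subsetPn[x Lx notMx]] := maxgroupp maxM.
exists M, x; split=> //; first exact: maxgroupp maxM.
apply/eqP; rewrite eqEproper join_subG sML cycle_subG Lx /=.
apply: contra notMx => prL.
have <- := (maxgroupP maxM).2 (M <*> <[x]>)%G prL (joing_subl _ _).
by rewrite -cycle_subG joing_subr.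
Qed.

Lemma index_pfactor_proper (gT : finGroupType) (K M L : {group gT}) p m :
    prime p -> K \subset M -> M \proper L -> #|L : K| = (p ^ m)%N ->
  exists2 m', (m' < m)%N & #|M : K| = (p ^ m')%N.
Proof.
move=> pr_p sKM prML iLK.
have /(dvdn_pfactor _ _ pr_p)[m' lem'm iMK] : #|M : K| %| p ^ m.
  rewrite -iLK -(Lagrange_index (proper_sub prML) sKM); exact: dvdn_mull.
exists m' => //; rewrite -(ltn_exp2l _ _ (prime_gt1 pr_p)) -iMK -iLK.
rewrite -(Lagrange_index (proper_sub prML) sKM).
by rewrite ltn_Pmull ?indexg_gt0 // indexg_gt1 proper_subn.
Qed.

(** Adding an element x to M multiplies the derived subgroup by the group of all
    [u, x] with u in M, an image of M / K.  Along a chain of subgroups from K to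
    L these images have order at most p^0, p^1, ..., p^(m-1). *)
Lemma class2_der1_bound (gT : finGroupType) (p m : nat) (K L : {group gT}) :
    prime p -> K \subset 'Z(L) -> L^`(1) \subset 'Z(L) -> #|L : K| = (p ^ m)%N ->
  #|L^`(1)| <= p ^ 'C(m, 2).
Proof.
move=> pr_p; have p_gt0 := prime_gt0 pr_p.
elim/ltn_ind: m L => m IHm L sKZ sL'Z iLK.
have /subsetIP[sKL cLK] := sKZ.
have [/eqP eKL | neKL] := boolP (K == L).
  rewrite -eKL in cLK *.
  by rewrite (derG1P _) ?cards1 ?expn_gt0 ?p_gt0 // -?eKL.
have [M [x [sKM prML Lx defL]]] := maximal_joing_cycle sKL neKL.
have [m' ltm'm iMK] := index_pfactor_proper pr_p sKM prML iLK.
have sML := proper_sub prML.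
have sM'Z : M^`(1) \subset 'Z(L) := subset_trans (dergS 1 sML) sL'Z.
have leM : #|M^`(1)| <= p ^ 'C(m', 2).
  have cMZ : 'Z(L) \subset 'C(M) by rewrite subIset // centS ?orbT.
  apply: IHm iMK => //; first by rewrite subsetI sKM (subset_trans sKZ).
  by rewrite subsetI der_sub (subset_trans sM'Z).
have MxZ : {in M, forall u, [~ u, x] \in 'Z(L)}.
  move=> u Mu; apply: (subsetP sL'Z); apply: mem_commg => //.
  exact: (subsetP sML).
have [|T [sTZ cardT MxT]] := commutator_image MxZ.
  by rewrite subIset // centS ?orbT.
have leT : #|T| <= p ^ m'.
  rewrite cardT -iMK dvdn_leq //.
  by rewrite indexgS // subsetI sKM sub_cent1 (subsetP _ x Lx) // centsC.
have cM'T : T \subset 'C(M^`(1)).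
  apply: subset_trans sTZ _.
  by rewrite subIset // centS ?(subset_trans sM'Z) ?subsetIl ?orbT.
have sL'MT : L^`(1) \subset M^`(1) <*> T.
  have sMTZ : M^`(1) <*> T \subset 'Z(L) by rewrite join_subG sM'Z.
  have nMT : L \subset 'N(M^`(1) <*> T).
    by rewrite cents_norm // centsC (subset_trans sMTZ) ?subsetIr.
  apply: der1_min => //.
  rewrite -{1}defL quotientY ?cycle_subG ?(subsetP nMT) ?(subset_trans sML) //.
  rewrite abelianY; apply/and3P; split.
  - by rewrite sub_der1_abelian // joing_subl.
  - by rewrite quotient_abelian // cycle_abelian.
  - have nMMT := subset_trans sML nMT.
    have nxT : x \in 'N(M^`(1) <*> T) := subsetP nMT x Lx.
    rewrite quotient_cycle // cycle_subG; apply/centP=> _ /morphimP[u Nu Mu ->].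
    apply/esym/commgP; rewrite -morphR //=; apply/eqP/coset_id.
    by rewrite (subsetP (joing_subr _ _)) ?MxT.
apply: leq_trans (subset_leq_card sL'MT) _.
rewrite cent_joinEr //; apply: (@leq_trans (#|M^`(1)| * #|T|)).
  by rewrite mul_cardG leq_pmulr ?cardG_gt0.
apply: leq_trans (leq_mul leM leT) _.
rewrite -expnD leq_exp2l ?prime_gt1 // -[X in _ + X]bin1 -binS.
by rewrite leq_bin2l.
Qed.

(** L is reached from K by adding at most m elements, and each of them contributes
    the image of X / C under commutation with it. *)
Lemma card_commutator_bound (gT : finGroupType) (p m : nat)
    (X C K L : {group gT}) :
    prime p -> X \subset 'C(K) -> C \subset X -> C \subset 'C(L) ->
    [~: X, L] \subset 'C(X <*> L) -> K \subset L -> #|L : K| = (p ^ m)%N ->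
  #|[~: X, L]| <= #|X : C| ^ m.
Proof.
move=> pr_p cKX sCX; elim/ltn_ind: m L => m IHm L cLC sXLZ sKL iLK.
have iXC_gt0 : 0 < #|X : C| by [].
have [/eqP eKL | neKL] := boolP (K == L).
  by rewrite -eKL (commG1P cKX) cards1 expn_gt0 iXC_gt0.
have [M [x [sKM prML Lx defL]]] := maximal_joing_cycle sKL neKL.
have [m' ltm'm iMK] := index_pfactor_proper pr_p sKM prML iLK.
have sML := proper_sub prML.
have sXM : [~: X, M] \subset [~: X, L] by rewrite commgS.
have leM : #|[~: X, M]| <= #|X : C| ^ m'.
  apply: IHm iMK => //; first exact: subset_trans cLC (centS sML).
  by apply: subset_trans sXM (subset_trans sXLZ _); rewrite centS ?genS ?setUS.
have /(_ _ _)[||T [sTZ cardT MxT]] := @commutator_image _ X [~: X, L]%G x.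
- by move=> u Xu; apply: mem_commg.
- by apply: subset_trans sXLZ _; rewrite centS ?joing_subl.
have leT : #|T| <= #|X : C|.
  rewrite cardT dvdn_leq // indexgS // subsetI sCX sub_cent1.
  by rewrite (subsetP _ x Lx) // centsC.
have cT : T \subset 'C([~: X, M]).
  apply: subset_trans sTZ (subset_trans sXLZ _).
  rewrite centS // comm_subG ?joing_subl //.
  by rewrite (subset_trans sML) ?joing_subr.
have sXLT : [~: X, L] \subset [~: X, M] <*> T.
  have cJ : [~: X, M] <*> T \subset 'C(X <*> L).
    by apply: subset_trans sXLZ; rewrite join_subG sXM.
  rewrite commGC -{1}defL; apply: commg_joing_cycle.
  - by rewrite defL (subset_trans cJ) ?centS ?joing_subr.
  - by rewrite (subset_trans cJ) ?centS ?joing_subl.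
  - by rewrite commGC joing_subl.
  - by move=> u Xu; rewrite (subsetP (joing_subr _ _)) ?MxT.
apply: leq_trans (subset_leq_card sXLT) _.
rewrite cent_joinEr //; apply: (@leq_trans (#|[~: X, M]| * #|T|)).
  by rewrite mul_cardG leq_pmulr ?cardG_gt0.
by apply: leq_trans (leq_mul leM leT) _; rewrite -expnSr leq_pexp2l.
Qed.

Lemma prime_index_joing_cycle (gT : finGroupType) (A B : {group gT}) (x : gT) :
  A \subset B -> prime #|B : A| -> x \in B -> x \notin A -> A <*> <[x]> = B.
Proof.
move=> sAB prBA Bx notAx.
have sJB : A <*> <[x]> \subset B by rewrite join_subG sAB cycle_subG.
apply/eqP; rewrite eqEsubset sJB /= -indexg_eq1.
have := Lagrange_index sJB (joing_subl A <[x]>).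
move: prBA => /primeP[_ prBA] E.
have /prBA/orP[// | /eqP iBJ] : #|B : A <*> <[x]>| %| #|B : A|.
  by rewrite -E dvdn_mulr.
move: E; rewrite iBJ -[RHS]muln1 => /eqP; rewrite eqn_pmul2l // indexg_eq1.
by rewrite join_subG cycle_subG (negPf notAx) andbF.
Qed.

Lemma commg_not_subP (gT : finGroupType) (A B : {set gT}) (T : {group gT}) :
  reflect (exists x y, [/\ x \in A, y \in B & [~ x, y] \notin T])
          (~~ ([~: A, B] \subset T)).
Proof.
rewrite gen_subG; apply: (iffP subsetPn).
  by case=> _ /imset2P[x y Ax By ->] nT; exists x, y.
case=> x [y [Ax By nT]].
by exists [~ x, y] => //; apply: imset2_f.
Qed.

Lemma commg_central_factors (gT : finGroupType) (x y a b : gT) (L : {group gT}) :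
    x \in L -> y \in L -> a \in 'Z(L) -> b \in 'Z(L) ->
  [~ x * a, y * b] = [~ x, y].
Proof.
move=> Lx Ly /centerP[La cLa] /centerP[Lb cLb].
have comm1 (u v : gT) : commute u v -> [~ u, v] = 1.
  by move=> cuv; apply/eqP/commgP.
rewrite commMgJ (comm1 a) ?mulg1; last by apply: cLa; rewrite groupM.
rewrite commgMJ (comm1 x b) ?mul1g; last exact/commute_sym/cLb.
have fixJ z (u : gT) : z \in L -> u \in 'Z(L) -> z ^ u = z.
  move=> Lz /centerP[_ cLu]; apply/conjg_fixP/commgP/commute_sym; exact: cLu.
by rewrite !fixJ ?groupR //; apply/centerP.
Qed.

(** The Jacobi identity in disguise.  Pick a commutator w = [x, y] that generates
    K2 modulo K3, so that [K2, L] consists of the [h, w].  An element h that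
    commutes with x and y modulo K3 changes them by central factors only, hence
    fixes w; and such elements h form a subgroup of index at most p^2. *)
Lemma class3_lcn3_bound (gT : finGroupType) (p : nat)
    (L K2 K3 : {group gT}) :
    prime p -> K3 \subset K2 -> K2 \subset L -> K3 \subset 'Z(L) ->
    L^`(1) \subset K2 -> [~: K2, L] \subset K3 -> #|K2 : K3| = p ->
    ~~ (L^`(1) \subset K3) ->
  #|[~: K2, L]| <= p ^ 2.
Proof.
move=> pr_p sK32 sK2L sK3Z sL'K2 sK2LK3 iK23.
move=> /commg_not_subP[x [y [Lx Ly notK3w]]].
have [sK3L cLK3] := subsetIP sK3Z.
have nK3L : L \subset 'N(K3) by rewrite cents_norm // centsC.
pose w := [~ x, y]; have K2w : w \in K2 by rewrite (subsetP sL'K2) ?mem_commg.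
have Lw : w \in L := subsetP sK2L w K2w.
have defK2 : K3 <*> <[w]> = K2.
  by apply: prime_index_joing_cycle; rewrite // iK23.
have index_cent (A : {group coset_of K3}) z :
    A \subset L / K3 -> z \in L -> #|A : 'C_A[coset K3 z]| <= p.
  move=> sAL Lz; have Nz := subsetP nK3L z Lz.
  have /(_ _ _)[||T [sTZ <- _]] := @commutator_image _ A (K2 / K3) (coset K3 z).
  - move=> _ /(subsetP sAL)/morphimP[u Nu Lu ->].
    rewrite -morphR // mem_quotient //.
    by apply: (subsetP sL'K2); apply: mem_commg.
  - by rewrite (subset_trans _ (centS sAL)) // quotient_cents2r.
  apply: leq_trans (subset_leq_card sTZ) _.
  by rewrite card_quotient ?iK23 // (subset_trans sK2L).
have index_Cw : #|L : 'C_L[w]| <= p ^ 2.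
  have sK3C : K3 \subset 'C_L[w].
    by rewrite subsetI sK3L sub_cent1 (subsetP _ w Lw) // centsC.
  have <- : #|L / K3 : 'C_L[w] / K3| = #|L : 'C_L[w]|.
    apply: index_quotient_eq => //.
      by rewrite (subset_trans (subsetIr L K3)).
    by rewrite subsetIl.
  set Lb := L / K3; pose Cx := 'C_Lb[coset K3 x]; pose Q := 'C_Cx[coset K3 y].
  have sCxL : Cx \subset Lb by rewrite subsetIl.
  have sQCx : Q \subset Cx by rewrite subsetIl.
  have sQC : Q \subset 'C_L[w] / K3.
    apply/subsetP=> _ /setIP[/setIP[/morphimP[h Nh Lh ->] cxh] cyh].
    apply: mem_quotient; rewrite in_setI Lh /=.
    apply/cent1P/commute_sym/commgP/conjg_fixP.
    have Zcomm z :
        z \in L -> coset K3 h \in 'C[coset K3 z] -> [~ z, h] \in 'Z(L).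
      move=> Lz /cent1P/commute_sym czh; apply: (subsetP sK3Z).
      have Nz := subsetP nK3L z Lz.
      by apply: coset_idr; rewrite ?groupR // morphR //; apply/eqP/commgP.
    rewrite conjRg 2!conjg_mulR.
    exact: commg_central_factors Lx Ly (Zcomm x Lx cxh) (Zcomm y Ly cyh).
  apply: leq_trans (_ : #|Lb : Q| <= _).
    by rewrite dvdn_leq // indexgS.
  by rewrite -(Lagrange_index sCxL sQCx) expnS leq_mul ?index_cent.
have cZL : [~: L, K2] \subset 'C(L) by rewrite commGC (subset_trans sK2LK3).
have /(_ _ _)[||T [sTZ cardT LwT]] := @commutator_image _ L [~: L, K2]%G w.
- by move=> u Lu; apply: mem_commg.
- exact: cZL.
rewrite -cardT in index_Cw; apply: leq_trans index_Cw; apply: subset_leq_card.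
have cTL := subset_trans sTZ cZL.
rewrite -defK2; apply: commg_joing_cycle => //.
  by rewrite defK2 (subset_trans cTL) ?centS.
by rewrite (commG1P cLK3) sub1G.
Qed.

Lemma commg_cosetE (gT : finGroupType) (K : {group gT}) (x y : gT) :
    x \in 'N(K) -> y \in 'N(K) ->
  ([~ x, y] \in K) = (coset K x \in 'C[coset K y]).
Proof.
move=> Nx Ny; rewrite (sameP cent1P commgP) -morphR //=.
by apply/idP/eqP => [/coset_id | /coset_idr -> //]; rewrite ?groupR.
Qed.

(** Elements w of K2 outside K3 generate K2 modulo K3, so they have the same
    centraliser P modulo K4, a subgroup of index p in L.  As L / P is cyclic,
    some y in P and x outside P have w = [x, y] outside K3.  Then u = [w, x]
    generates K3 modulo K4, and u commutes with y: conjugation by y multiplies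
    w by a central factor and x by w, and w commutes with itself and with u.  So
    the morphism h |-> [h, u], whose image is [K3, L], kills not only K2 but also
    y, which lies outside K2. *)
Lemma class4_lcn4_bound (gT : finGroupType) (p m : nat)
    (L K2 K3 K4 : {group gT}) :
    prime p -> K3 \subset K2 -> K2 \subset L -> K4 \subset K3 -> K4 \subset 'Z(L) ->
    L^`(1) \subset K2 -> [~: K2, L] \subset K3 -> [~: K3, L] \subset K4 ->
    K2 \subset 'C(K3) -> #|K2 : K3| = p -> #|K3 : K4| = p ->
    ~~ (L^`(1) \subset K3) -> ~~ ([~: K2, L] \subset K4) ->
    #|L : K2| = (p ^ m)%N ->
  #|[~: K3, L]| <= p ^ m.-1.
Proof.
move=> pr_p sK32 sK2L sK43 sK4Z sL'K2 sK2LK3 sK3LK4 cK32 iK23 iK34.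
move=> nsL'K3 nsK2LK4 iLK2.
have [sK4L cLK4] := subsetIP sK4Z.
have nK4L : L \subset 'N(K4) by rewrite cents_norm // centsC.
have sK3L := subset_trans sK32 sK2L.
have nK3L : L \subset 'N(K3).
  by rewrite -commg_subl (subset_trans sK3LK4).
have N4 z : z \in L -> z \in 'N(K4) by apply: (subsetP nK4L).
pose P := (L :&: coset K4 @*^-1 'C(K2 / K4))%G.
have PP h : h \in L -> (h \in P) = (K2 / K4 \subset 'C[coset K4 h]).
  by move=> Lh; rewrite sub_cent1 in_setI Lh /= morphpreE in_setI N4 //= inE.
have PE h v :
    h \in L -> v \in K2 -> v \notin K3 -> (h \in P) = ([~ v, h] \in K4).
  move=> Lh K2v nK3v; have Lv := subsetP sK2L v K2v.
  rewrite PP // -(@prime_index_joing_cycle _ K3 K2 v) // ?iK23 //.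
  rewrite quotientY ?cycle_subG ?N4 ?(subset_trans sK3L) // join_subG.
  rewrite quotient_cycle ?N4 // cycle_subG -commg_cosetE ?N4 // andb_idl //.
  rewrite sub_cent1 (subsetP _ _ (mem_quotient _ Lh)) // quotient_cents2r //.
  by rewrite commGC.
have [v [h [K2v Lh nK4vh]]] := elimT (commg_not_subP _ _ _) nsK2LK4.
have Lv := subsetP sK2L v K2v.
have nK3v : v \notin K3.
  by apply: contra nK4vh => K3v; apply: (subsetP sK3LK4); apply: mem_commg.
have notPh : h \notin P by rewrite (PE h v).
have defL : P <*> <[h]> = L.
  apply: prime_index_joing_cycle => //; first by rewrite subsetIl.
  have sK4P : K4 \subset P.
    apply/subsetP=> k K4k; have Lk := subsetP sK4L k K4k; rewrite (PE k v) //.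
    by rewrite -groupV invgR commgEl groupMl ?groupV // memJ_norm ?N4.
  have <- : #|L / K4 : P / K4| = #|L : P|.
    apply: index_quotient_eq => //.
      by rewrite (subset_trans (subsetIr L K4)).
    by rewrite subsetIl.
  have -> : P / K4 = 'C_(L / K4)[coset K4 v].
    apply/setP=> z; apply/idP/setIP.
      case/morphimP=> g _ Pg ->.
      have Lg : g \in L by apply: subsetP Pg; rewrite subsetIl.
      by rewrite mem_quotient // -cent1C -commg_cosetE ?N4 // -PE.
    case=> /morphimP[g _ Lg ->].
    by rewrite -cent1C -commg_cosetE ?N4 // -PE //; apply: mem_quotient.
  have /(_ _ _)[||T [sTZ cardT _]] :=
    @commutator_image _ (L / K4) (K3 / K4) (coset K4 v).
  - move=> _ /morphimP[g Ng Lg ->]; rewrite -morphR ?N4 // mem_quotient //.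
    by rewrite -groupV invgR; apply: (subsetP sK2LK3); apply: mem_commg.
  - exact: quotient_cents2r.
  rewrite -cardT; have := cardSg sTZ.
  rewrite card_quotient ?(subset_trans sK3L) // iK34.
  case/primeP: (pr_p) => _ pdiv /pdiv/orP[|/eqP->] //.
  rewrite cardT indexg_eq1 => /subsetP/(_ (coset K4 h)).
  rewrite mem_quotient // => /(_ isT) /setIP[_].
  by rewrite cent1C -commg_cosetE ?N4 // (negPf nK4vh).
have nsPLK3 : ~~ ([~: P, L] \subset K3).
  apply: contra nsL'K3 => sPLK3; apply: der1_min => //.
  have sPL : P \subset L by rewrite subsetIl.
  have shL : <[h]> \subset L by rewrite cycle_subG.
  rewrite -{1}defL quotientY ?(subset_trans _ nK3L) // abelianY.
  apply/and3P; split.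
  - by apply: quotient_cents2r; apply: subset_trans sPLK3; rewrite commgS.
  - by rewrite quotient_abelian ?cycle_abelian.
  - apply: quotient_cents2r; rewrite commGC.
    by apply: subset_trans sPLK3; rewrite commgS.
have [y [x0 [Py Lx0 nK3yx0]]] := elimT (commg_not_subP _ _ _) nsPLK3.
have [x [Lx notPx nK3yx]] :
    exists x, [/\ x \in L, x \notin P & [~ y, x] \notin K3].
  have [Px0 | ] := boolP (x0 \in P); last by exists x0.
  have [K3yh | ] := boolP ([~ y, h] \in K3); last by exists h.
  exists (x0 * h); rewrite groupM // groupMl //; split=> //.
  by rewrite commgMJ groupMl // memJ_norm // (subsetP nK3L).
have Ly : y \in L by apply: subsetP Py; rewrite subsetIl.
pose w := [~ x, y].
have nK3w : w \notin K3 by rewrite -groupV invgR.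
have K2w : w \in K2 by apply: (subsetP sL'K2); apply: mem_commg.
pose u := [~ w, x].
have K3u : u \in K3 by apply: (subsetP sK2LK3); apply: mem_commg.
have nK4u : u \notin K4 by rewrite -PE.
have K4wy : [~ w, y] \in K4 by rewrite -PE.
have Lw := subsetP sK2L w K2w.
have cuw : u ^ w = u.
  by apply/conjg_fixP/commgP/commute_sym; apply: (centsP cK32).
have cuy : u ^ y = u.
  rewrite {1}/u conjRg !conjg_mulR -/w.
  have Zwy := subsetP sK4Z _ K4wy; have Lxw := groupM Lx Lw.
  rewrite -[x * w]mulg1 (commg_central_factors Lw Lxw Zwy (group1 _)).
  by rewrite commgMJ commgg mul1g -/u.
have notK2y : y \notin K2.
  apply: contra nK3yx => K2y; apply: (subsetP sK2LK3); exact: mem_commg.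
have sJC : K2 <*> <[y]> \subset 'C_L[u].
  rewrite join_subG cycle_subG !subsetI sK2L in_setI Ly /=; apply/andP; split.
    by rewrite sub_cent1; apply: subsetP K3u; rewrite centsC.
  rewrite cent1C; apply/cent1P/commgP/conjg_fixP; exact: cuy.
have leCu : #|L : 'C_L[u]| <= p ^ m.-1.
  have sJL : K2 <*> <[y]> \subset L by rewrite join_subG sK2L cycle_subG.
  have JK2_gt1 : 1 < #|K2 <*> <[y]> : K2|.
    by rewrite indexg_gt1 join_subG cycle_subG (negPf notK2y) andbF.
  have iLJ := Lagrange_index sJL (joing_subl K2 <[y]>); rewrite iLK2 in iLJ.
  apply: leq_trans (_ : #|L : K2 <*> <[y]>| <= _).
    by rewrite dvdn_leq // indexgS.
  have /(dvdn_pfactor _ _ pr_p)[m' lem'm iLJ'] : #|L : K2 <*> <[y]>| %| p ^ m.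
    by rewrite -iLJ dvdn_mulr.
  rewrite iLJ' leq_exp2l ?prime_gt1 // -ltnS; apply: leq_trans (leqSpred m).
  rewrite -(ltn_exp2l _ _ (prime_gt1 pr_p)) -iLJ iLJ' ltn_Pmulr //.
  by rewrite expn_gt0 prime_gt0.
have /(_ _ _)[||T [sTZ cardT LwT]] := @commutator_image _ L [~: L, K3]%G u.
- by move=> g Lg; apply: mem_commg.
- by rewrite /= commGC (subset_trans sK3LK4).
rewrite -cardT in leCu; apply: leq_trans leCu; apply: subset_leq_card.
have cTL : T \subset 'C(L).
  by apply: subset_trans sTZ _; rewrite /= commGC (subset_trans sK3LK4).
have defK3 : K4 <*> <[u]> = K3.
  by apply: prime_index_joing_cycle; rewrite // iK34.
rewrite -defK3; apply: commg_joing_cycle => //.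
  by rewrite defK3 (subset_trans cTL) ?centS.
by rewrite (commG1P cLK4) sub1G.
Qed.

End CommutatorBounds.

(** * The lower central series of a central extension *)

Section CentralExtensionBound.
Local Open Scope group_scope.

Section CentralLowerSeries.
Variables (gT : finGroupType) (E D : {group gT}).
Hypothesis sDZ : D \subset 'Z(E).

Let sDE : D \subset E. Proof. by case/subsetIP: sDZ. Qed.
Let cDE : D \subset 'C(E). Proof. by case/subsetIP: sDZ. Qed.

Lemma lcnY_sub i : 'L_i(E) <*> D \subset E.
Proof. by rewrite join_subG lcn_sub. Qed.

Lemma lcnY_subS i j : i <= j -> 'L_j(E) <*> D \subset 'L_i(E) <*> D.
Proof. by move=> leij; rewrite genS ?setSU ?lcn_sub_leq. Qed.

Lemma lcnY_comm i : [~: 'L_i.+1(E) <*> D, E] = 'L_i.+2(E).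
Proof.
apply/eqP; rewrite eqEsubset lcnSn [X in _ && X]commSg ?joing_subl // andbT.
rewrite cent_joinEr; last by rewrite (subset_trans cDE) ?centS ?lcn_sub.
rewrite commMG; first by rewrite (commG1P cDE) mulg1.
exact: subset_trans sDE (lcn_norm i.+2 E).
Qed.

Lemma lcnY_cent i : 'L_i.+2(E) = 1 -> 'L_i.+1(E) <*> D \subset 'Z(E).
Proof.
by move=> L1; rewrite subsetI lcnY_sub; apply/commG1P; rewrite lcnY_comm.
Qed.

(** The commutator of the second and the (i + 1)-st term of the lower central
    series lies in the (i + 3)-rd, by the three subgroups lemma. *)
Lemma lcn2Y_cent i :
  'L_i.+3(E) = 1 -> 'L_2(E) <*> D \subset 'C('L_i.+1(E) <*> D).
Proof.
move=> L1.
have cL2 : [~: E, E, 'L_i.+1(E)] = 1.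
  by apply: three_subgroup; rewrite ?[[~: E, 'L_i.+1(E)]]commGC -!lcnSn.
have cDL j : D \subset 'C('L_j(E)).
  by rewrite (subset_trans cDE) ?centS ?lcn_sub.
rewrite join_subG andbC (subset_trans cDE) ?centS ?lcnY_sub //= centsC join_subG.
by rewrite cDL centsC andbT; apply/commG1P.
Qed.

Variables (p m : nat).
Hypothesis pr_p : prime p.
Hypothesis iEK : #|E : 'L_2(E) <*> D| = (p ^ m)%N.

Lemma card_lcn2_bound : 'L_3(E) = 1 -> #|'L_2(E)| <= p ^ 'C(m, 2).
Proof.
move=> L1; have sKZ := lcnY_cent L1.
apply: (class2_der1_bound pr_p sKZ _ iEK).
by apply: subset_trans sKZ; rewrite joing_subl.
Qed.

Lemma card_lcnS_bound i :
  'L_i.+3(E) = 1 -> #|'L_i.+2(E)| <= #|'L_i.+1(E) <*> D : 'L_i.+2(E) <*> D| ^ m.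
Proof.
move=> L1; rewrite -{1}lcnY_comm.
apply: (card_commutator_bound pr_p _ _ _ _ (lcnY_sub 2) iEK).
- by rewrite centsC lcn2Y_cent.
- exact: lcnY_subS.
- by rewrite (subset_trans (lcnY_cent _)) ?subsetIr // lcnSn L1 comm1G.
- rewrite lcnY_comm (subset_trans _ (_ : 'Z(E) \subset _)) //.
    by rewrite (subset_trans (joing_subl _ D)) ?lcnY_cent.
  by rewrite subIset // centS ?orbT // join_subG lcnY_sub subxx.
Qed.

Lemma card_lcn3_bound : 'L_4(E) = 1 ->
  #|'L_2(E) <*> D : 'L_3(E) <*> D| = p -> #|'L_3(E)| <= p ^ 2.
Proof.
move=> L1 iK23; rewrite -lcnY_comm.
apply: (class3_lcn3_bound pr_p _ _ (lcnY_cent L1) _ _ iK23).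
- exact: lcnY_subS.
- exact: lcnY_sub.
- exact: joing_subl.
- by rewrite lcnY_comm joing_subl.
apply: contraL (prime_gt1 pr_p) => sL2K3; rewrite -iK23 -leqNgt.
rewrite leq_eqVlt indexg_eq1 join_subG joing_subr andbT.
by rewrite sL2K3.
Qed.

Lemma card_lcn4_bound : 'L_5(E) = 1 ->
  #|'L_2(E) <*> D : 'L_3(E) <*> D| = p ->
  #|'L_3(E) <*> D : 'L_4(E) <*> D| = p ->
  #|'L_4(E)| <= p ^ m.-1.
Proof.
move=> L1 iK23 iK34; rewrite -lcnY_comm.
have nsK i :
    #|'L_i(E) <*> D : 'L_i.+1(E) <*> D| = p ->
  ~~ ('L_i(E) \subset 'L_i.+1(E) <*> D).
  apply: contra_eqN => sLK; rewrite eq_sym neq_ltn; apply/orP; right.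
  suff /eqP-> : #|'L_i(E) <*> D : 'L_i.+1(E) <*> D| == 1%N by exact: prime_gt1.
  by rewrite indexg_eq1 join_subG joing_subr andbT.
apply: (class4_lcn4_bound pr_p _ _ _ (lcnY_cent L1)
          _ _ _ _ iK23 iK34 _ _ iEK).
- exact: lcnY_subS.
- exact: lcnY_sub.
- exact: lcnY_subS.
- exact: joing_subl.
- by rewrite lcnY_comm joing_subl.
- by rewrite lcnY_comm joing_subl.
- exact: lcn2Y_cent.
- exact: (nsK 2 iK23).
- rewrite lcnY_comm; exact: (nsK 3 iK34).
Qed.
End CentralLowerSeries.

Section CentralLowerSeriesQuotient.
Variables (gT : finGroupType) (E D : {group gT}).
Hypothesis sDZ : D \subset 'Z(E).

Let sDE : D \subset E. Proof. by case/subsetIP: sDZ. Qed.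

Lemma quotient_lcn n i : 'L_i(E) / 'L_n(E) = 'L_i(E / 'L_n(E)).
Proof. exact: morphim_lcn (lcn_norm n E). Qed.

Lemma quotient_lcnY n i :
  ('L_i(E) <*> D) / 'L_n(E) = 'L_i(E / 'L_n(E)) <*> (D / 'L_n(E)).
Proof.
have nLE := lcn_norm n E; have nLL := subset_trans (lcn_sub i E) nLE.
by rewrite quotientY ?quotient_lcn // (subset_trans sDE).
Qed.

Lemma quotient_lcn_central n : D / 'L_n(E) \subset 'Z(E / 'L_n(E)).
Proof. by apply: subset_trans (quotientS _ sDZ) _; apply: morphim_center. Qed.

Lemma index_quotient_lcnY n i j : i <= j -> j <= n ->
  #|'L_i(E / 'L_n(E)) <*> (D / 'L_n(E)) : 'L_j(E / 'L_n(E)) <*> (D / 'L_n(E))|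
    = #|'L_i(E) <*> D : 'L_j(E) <*> D|.
Proof.
move=> leij lejn; rewrite -!quotient_lcnY; apply: index_quotient_eq.
- by rewrite subIset // (subset_trans (lcn_sub_leq _ lejn)) ?joing_subl ?orbT.
- exact: lcnY_subS.
- exact: subset_trans (lcnY_sub sDZ i) (lcn_norm n E).
Qed.

Lemma card_lcn_quotient i j :
  i <= j -> #|'L_i(E / 'L_j(E))| = #|'L_i(E) : 'L_j(E)|.
Proof.
move=> leij; rewrite -quotient_lcn card_quotient //.
exact: subset_trans (lcn_sub i E) (lcn_norm j E).
Qed.

Lemma lcn_quotient1 n : 'L_n(E / 'L_n(E)) = 1.
Proof. by rewrite -quotient_lcn trivg_quotient. Qed.

Variables (p m : nat).
Hypothesis pr_p : prime p.
Hypothesis iEK : #|E : 'L_2(E) <*> D| = (p ^ m)%N.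

Let iEKq n :
  #|E / 'L_n.+2(E) : 'L_2(E / 'L_n.+2(E)) <*> (D / 'L_n.+2(E))| = (p ^ m)%N.
Proof.
rewrite -quotient_lcnY -iEK; apply: index_quotient_eq; last exact: lcn_norm.
  have le2n : 2 <= n.+2 by [].
  by rewrite subIset // (subset_trans (lcn_sub_leq E le2n)) ?joing_subl ?orbT.
exact: lcnY_sub.
Qed.

Lemma index_lcn2_bound : #|'L_2(E) : 'L_3(E)| <= p ^ 'C(m, 2).
Proof.
rewrite -card_lcn_quotient //.
exact: (card_lcn2_bound (quotient_lcn_central 3) pr_p (iEKq 1)
          (lcn_quotient1 3)).
Qed.

Lemma index_lcnS_bound i :
  #|'L_i.+2(E) : 'L_i.+3(E)| <= #|'L_i.+1(E) <*> D : 'L_i.+2(E) <*> D| ^ m.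
Proof.
rewrite -card_lcn_quotient // -(@index_quotient_lcnY i.+3) //.
exact: (card_lcnS_bound (quotient_lcn_central i.+3) pr_p (iEKq i.+1)
          (lcn_quotient1 i.+3)).
Qed.

Lemma index_lcn3_bound :
  #|'L_2(E) <*> D : 'L_3(E) <*> D| = p -> #|'L_3(E) : 'L_4(E)| <= p ^ 2.
Proof.
rewrite -card_lcn_quotient // -(@index_quotient_lcnY 4) //.
exact: (card_lcn3_bound (quotient_lcn_central 4) pr_p (lcn_quotient1 4)).
Qed.

Lemma index_lcn4_bound :
  #|'L_2(E) <*> D : 'L_3(E) <*> D| = p ->
  #|'L_3(E) <*> D : 'L_4(E) <*> D| = p ->
  #|'L_4(E) : 'L_5(E)| <= p ^ m.-1.
Proof.
rewrite -card_lcn_quotient // -!(@index_quotient_lcnY 5) //.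
exact: (card_lcn4_bound (quotient_lcn_central 5) pr_p (iEKq 3)
          (lcn_quotient1 5)).
Qed.

(** The product of the bounds on all factors from the (j + 2)-nd term on.  The
    series reaches the trivial group one step after it has entered D. *)
Lemma card_lcn_bound n j : 'L_(n + j).+1(E) \subset D ->
  #|'L_j.+2(E)| <= #|'L_j.+1(E) <*> D : D| ^ m.
Proof.
elim: n j => [|n IHn] j sLD.
  have -> : 'L_j.+2(E) = 1.
    rewrite lcnSn; apply/commG1P; apply: subset_trans sLD _.
    by case/subsetIP: sDZ.
  by rewrite cards1 expn_gt0 indexg_gt0.
have le_tail := IHn j.+1; rewrite addnS in le_tail.
rewrite -(Lagrange (lcn_subS j.+2 E)) mulnC.
rewrite -(Lagrange_index (lcnY_subS E D (leqnSn j.+1)) (joing_subr _ D)).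
by rewrite expnMn leq_mul ?index_lcnS_bound ?le_tail.
Qed.

End CentralLowerSeriesQuotient.

Lemma lcn_proper (gT : finGroupType) (j : nat) (G : {group gT}) :
  nilpotent G -> j < nil_class G -> 'L_j.+2(G) \proper 'L_j.+1(G).
Proof.
move=> nilG ltjc; rewrite lcnSn; apply: (nil_comm_properl nilG).
- exact: lcn_sub.
- by apply/eqP=> /(lcn_nil_classP _ nilG); rewrite leqNgt ltjc.
- by rewrite subsetI subxx lcn_norm.
Qed.

Lemma pgroup_lcn_ltn (gT : finGroupType) (p j a b : nat) (G : {group gT}) :
    prime p -> nilpotent G -> j < nil_class G ->
    #|'L_j.+1(G)| = (p ^ a)%N -> #|'L_j.+2(G)| = (p ^ b)%N -> b < a.
Proof.
move=> pr_p nilG ltjc cardL cardLS; have := proper_card (lcn_proper nilG ltjc).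
by rewrite cardL cardLS ltn_exp2l ?prime_gt1.
Qed.

Lemma pgroup_lcn_geq (gT : finGroupType) (p n j a : nat) (G : {group gT}) :
    prime p -> p.-group G -> (n + j)%N = nil_class G ->
    #|'L_j.+1(G)| = (p ^ a)%N ->
  n <= a.
Proof.
move=> pr_p pG; elim: n j a => [//|n IHn] j a defc cardL.
have [b cardLS] := p_natP (pgroupS (lcn_sub j.+2 G) pG).
have ltba : b < a.
  apply: (pgroup_lcn_ltn pr_p (pgroup_nil pG) _ cardL cardLS).
  by rewrite -defc addSn ltnS leq_addl.
by apply: leq_ltn_trans ltba; apply: IHn cardLS; rewrite addnS.
Qed.

(** In a central extension E of a p-group by D, the part of D inside the derived
    subgroup has order |E'| / |(E / D)'|, so an upper bound for |E'| suffices. *)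
Theorem central_extension_bound (gT : finGroupType) (E D : {group gT})
    (p r k : nat) :
    prime p -> D \subset 'Z(E) -> p.-group (E / D) -> 2 < nil_class (E / D) ->
    logn p #|E / D| - nil_class (E / D) = r -> #|(E / D)^`(1)| = (p ^ k)%N ->
  #|D :&: E^`(1)| <= p ^ ('C(r, 2) + k * r).
Proof.
move=> pr_p sDZ pG lt2c defr cardG'; have p_gt1 := prime_gt1 pr_p.
have p_gt0 := ltnW p_gt1; set G := E / D in pG lt2c defr cardG'.
have [sDE cDE] := subsetIP sDZ.
have nDE : E \subset 'N(D) by rewrite cents_norm // centsC.
have nDL i : 'L_i(E) \subset 'N(D) := subset_trans (lcn_sub i E) nDE.
have LG i : 'L_i(G) = ('L_i(E) <*> D) / D.
  by rewrite quotientYidr ?nDL //; exact: (esym (morphim_lcn _ i nDE)).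
have cardLG i : #|'L_i(G)| = #|'L_i(E) <*> D : D|.
  by rewrite LG card_quotient // join_subG nDL normG.
have indexLG i j :
    i <= j -> #|'L_i(G) : 'L_j(G)| = #|'L_i(E) <*> D : 'L_j(E) <*> D|.
  move=> leij; rewrite !LG index_quotient_eq ?lcnY_subS //.
    by rewrite subIset // joing_subr orbT.
  by rewrite join_subG nDL normG.
have pexp i : exists e, #|'L_i(G)| = (p ^ e)%N.
  by have [e] := p_natP (pgroupS (lcn_sub i G) pG); exists e.
have [n cardG] := pexp 1%N; have [k3 card3] := pexp 3; have [k4 card4] := pexp 4.
set c := nil_class G in lt2c defr.
have nilG := pgroup_nil pG.
have ltk3 : k3 < k.
  by apply: (@pgroup_lcn_ltn _ p 1 k k3 (E / D)%G) => //; apply: ltnW.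
have ltk4 : k4 < k3 by apply: (@pgroup_lcn_ltn _ p 2 k3 k4 (E / D)%G).
have lek4 : c - 3 <= k4.
  by apply: (@pgroup_lcn_geq _ p _ 3 _ (E / D)%G) => //; rewrite subnK.
have lecn : c <= n.
  by apply: (@pgroup_lcn_geq _ p _ 0 _ (E / D)%G); rewrite ?addn0.
have [m cardGab defn] :
    exists2 m, #|E : 'L_2(E) <*> D| = (p ^ m)%N & n = (m + k)%N.
  have := indexLG 1%N 2 isT; rewrite [X in _ = #|X : _|](joing_idPl _) // => iE.
  have [m iG] := p_natP (pnat_dvd (dvdn_indexg _ 'L_2(G)) pG).
  exists m; first by rewrite -iE.
  apply: (expnI p_gt1); rewrite expnD -cardG -(Lagrange (lcn_subS 1%N G)).
  by rewrite mulnC iG cardG'.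
have {}defr : r = (n - c)%N by rewrite -defr [#|G|]cardG pfactorK.
have iK2D : #|'L_2(E) <*> D : D| = (p ^ k)%N by rewrite -cardLG.
have cardA : (#|D :&: E^`(1)| * p ^ k)%N = #|E^`(1)|.
  rewrite -iK2D setIC -(LagrangeI E^`(1) D).
  by rewrite joingC norm_joinEr ?nDL // indexMg.
have [n0 L0] : exists n0, 'L_(n0 + 4).+1(E) \subset D.
  exists c; rewrite -quotient_sub1 //.
  rewrite (_ : _ / D = 'L_(c + 4).+1(G)); last exact: morphim_lcn nDE.
  by rewrite (lcn_nil_classP _ nilG _) // leq_addr.
have le2 := index_lcn2_bound sDZ pr_p cardGab.
have le3 : #|'L_3(E)| <= p ^ (k * m).
  have := @card_lcn_bound _ _ _ sDZ _ _ pr_p cardGab (n0 + 3)%N 1%N.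
  by rewrite -addnA iK2D expnM; apply.
rewrite -(@leq_pmul2r (p ^ k)) ?expn_gt0 ?p_gt0 // cardA -expnD.
(* Here m <= r, and the general bounds suffice. *)
have [lek | ltkc] := leqP c k.
  have lemr : m <= r by lia.
  rewrite -(Lagrange (lcn_subS 2 E)) mulnC.
  apply: leq_trans (leq_mul le2 le3) _; rewrite -expnD leq_pexp2l //.
  rewrite -addnA leq_add ?leq_bin2l //.
  by rewrite (leq_trans _ (leq_addr _ _)) // leq_mul.
(* Here the orders of the terms of the lower central series of G are as small as
   its class permits, so the first two factors below G' have order p. *)
have defk3 : k3 = k4.+1 by lia.
have defk : k = k4.+2 by lia.
have defm : m = r.+1 by lia.
have iK i e : #|'L_i(G)| = (p ^ e.+1)%N -> #|'L_i.+1(G)| = (p ^ e)%N ->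
   #|'L_i(E) <*> D : 'L_i.+1(E) <*> D| = p.
  move=> cardi cardS; rewrite -indexLG //; have := Lagrange (lcn_subS i G).
  rewrite cardi cardS expnSr => /eqP.
  by rewrite eqn_pmul2l ?expn_gt0 ?p_gt0 // => /eqP.
have iK23 : #|'L_2(E) <*> D : 'L_3(E) <*> D| = p.
  by apply: (iK _ k3) => //; rewrite [LHS]cardG' defk defk3.
have iK34 : #|'L_3(E) <*> D : 'L_4(E) <*> D| = p.
  by apply: (iK _ k4) => //; rewrite -defk3.
have le34 := index_lcn3_bound sDZ pr_p iK23.
have le45 := index_lcn4_bound sDZ pr_p cardGab iK23 iK34.
have le5 : #|'L_5(E)| <= p ^ (k4 * m).
  have := @card_lcn_bound _ _ _ sDZ _ _ pr_p cardGab (n0 + 1)%N 3.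
  by rewrite -addnA -(cardLG 4) card4 expnM; apply.
rewrite -(Lagrange (lcn_subS 2 E)) -(Lagrange (lcn_subS 3 E)).
rewrite -(Lagrange (lcn_subS 4 E)).
apply: leq_trans (leq_mul (leq_mul (leq_mul le5 le45) le34) le2) _.
rewrite -!expnD leq_pexp2l // defm defk binS bin1 /=; lia.
Qed.

End CentralExtensionBound.

(** * The central extension of a 2-cocycle *)

Section CocycleExtensions.
Import GRing.Theory.
Local Open Scope ring_scope.

Definition cocycle2 (gT : finGroupType) (V : zmodType) (f : gT -> gT -> V) :=
  forall g h k, f h k - f (g * h)%g k + f g (h * k)%g - f g h = 0.

Section CocycleExtension.
Variables (gT : finGroupType) (D : finZmodType) (f : gT -> gT -> D).
Hypothesis fP : cocycle2 f.

Lemma cocycle2E g h k : f g h + f (g * h)%g k = f h k + f g (h * k)%g.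
Proof.
by have /eqP := fP g h k; rewrite subr_eq0 addrAC subr_eq => /eqP->.
Qed.

Lemma cocycle2_1l g : f 1%g g = f 1%g 1%g.
Proof. by have := cocycle2E 1 1 g; rewrite !mul1g addrC => /addrI. Qed.

Lemma cocycle2_1r g : f g 1%g = f 1%g 1%g.
Proof. by have := cocycle2E g 1 1; rewrite !mulg1 => /addIr. Qed.

(** The proof is a parameter so that the group structure can be inferred. *)
Definition cocycle_ext of cocycle2 f : Type := (D * gT)%type.
Local Notation ext := (cocycle_ext fP).

HB.instance Definition _ := Finite.on ext.

Definition ext_mul (x y : ext) : ext := (x.1 + y.1 + f x.2 y.2, (x.2 * y.2)%g).

(** The bar cocycle is not normalised: f 1 1 may differ from 0. *)
Definition ext_one : ext := (- f 1%g 1%g, 1%g).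
Definition ext_inv (x : ext) : ext :=
  (- x.1 - f x.2^-1%g x.2 - f 1%g 1%g, x.2^-1%g).

Lemma ext_mulA : associative ext_mul.
Proof.
move=> [a g] [b h] [c k]; rewrite /ext_mul /= mulgA; congr (_, _).
transitivity (a + b + c + (f h k + f g (h * k)%g)); first by rewrite !addrA.
by rewrite -cocycle2E addrA; congr (_ + _); rewrite addrAC.
Qed.

Lemma ext_mul1 : left_id ext_one ext_mul.
Proof.
by move=> [a g]; rewrite /ext_mul /= mul1g cocycle2_1l addrAC addNr add0r.
Qed.

Lemma ext_mulV : left_inverse ext_one ext_inv ext_mul.
Proof.
move=> [a g]; rewrite /ext_mul /= mulVg; congr (_, _).
by rewrite -!opprD -addrA addrC opprD addrA subrr add0r.
Qed.

HB.instance Definition _ := Finite_isGroup.Build ext ext_mulA ext_mul1 ext_mulV.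

Lemma ext_mulE (x y : ext) : (x * y)%g = ext_mul x y. Proof. by []. Qed.

(** The shift by f 1 1 makes this a homomorphism. *)
Definition ext_in (d : D) : ext := (d - f 1%g 1%g, 1%g).

Definition ext_lift (g : gT) : ext := (0, g).

Lemma ext_in_inj : injective ext_in.
Proof. by move=> d d' [] /addIr. Qed.

Lemma ext_inD d d' : ext_in (d + d') = (ext_in d * ext_in d')%g.
Proof.
rewrite ext_mulE /ext_mul /= mulg1; congr (_, _).
by rewrite -!addrA addNr addr0 [- _ + d']addrC.
Qed.

Lemma ext_in_mull d (x : ext) : (ext_in d * x)%g = (d + x.1, x.2) :> ext.
Proof.
rewrite ext_mulE /ext_mul /= mul1g cocycle2_1l; congr (_, _).
by rewrite addrAC addrNK.
Qed.

Lemma ext_in_mulr d (x : ext) : (x * ext_in d)%g = (d + x.1, x.2) :> ext.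
Proof.
rewrite ext_mulE /ext_mul /= mulg1 cocycle2_1r; congr (_, _).
by rewrite addrA addrNK addrC.
Qed.

Lemma ext_lift_mul g h :
  (ext_lift g * ext_lift h)%g = (ext_in (f g h) * ext_lift (g * h))%g.
Proof. by rewrite ext_in_mull ext_mulE /ext_mul /= !add0r addr0. Qed.

Definition ext_proj (x : ext) : gT := x.2.

Lemma ext_projM : {in [set: ext] &, {morph ext_proj : x y / (x * y)%g}}.
Proof. by []. Qed.

Canonical ext_proj_morphism := Morphism ext_projM.

Lemma ker_ext_proj_central : ('ker ext_proj \subset 'Z([set: ext]))%g.
Proof.
apply/subsetP=> -[a g] ker_ag; apply/centerP; split; rewrite ?inE // => y _.
have /= -> : g = 1%g by apply: (kerP _ _ ker_ag); rewrite inE.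
have -> : (a, 1%g) = ext_in (a + f 1%g 1%g) by rewrite /ext_in addrK.
by rewrite /commute ext_in_mull ext_in_mulr.
Qed.

Lemma ext_in_ker d : ext_in d \in ('ker ext_proj)%g.
Proof. by apply/kerP; rewrite ?inE. Qed.

Lemma ext_quotient_isog : ([set: ext] / 'ker ext_proj \isog [set: gT])%g.
Proof.
have <- : (ext_proj @* [set: ext] = [set: gT])%g; last exact: first_isog.
apply/setP=> g; rewrite inE; apply/morphimP.
by exists (ext_lift g); rewrite ?inE.
Qed.

End CocycleExtension.

Section AdditiveView.
Variable qT : finGroupType.
Hypothesis qC : forall x y : qT, commute x y.

(** The additive group of a commutative multiplicative one, in which integral
    chains can be evaluated. *)
Definition additive_view of (forall x y : qT, commute x y) : Type := qT.
Local Notation Q := (additive_view qC).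

HB.instance Definition _ := Choice.on Q.

Let addQ (x y : Q) : Q := (x * y)%g.
Let addQA : associative addQ. Proof. exact: mulgA. Qed.
Let addQC : commutative addQ. Proof. by move=> x y; apply: qC. Qed.
Let add0Q : left_id (1%g : Q) addQ. Proof. exact: mul1g. Qed.
Let addNQ : left_inverse (1%g : Q) (fun x : Q => (x^-1)%g) addQ.
Proof. exact: mulVg. Qed.

HB.instance Definition _ := GRing.isZmodule.Build Q addQA addQC add0Q addNQ.

End AdditiveView.

End CocycleExtensions.

From mathcomp Require Import boolp classical_sets cardinality.

(** * The second homology of a finite group *)

Section Homology.
Import GRing.Theory Num.Theory.
Local Open Scope quotient_scope.
Local Open Scope ring_scope.

Section Chains.
Variable gT : finGroupType.
Local Notation chain1 := {ffun gT -> int}.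
Local Notation chain2 := {ffun gT * gT -> int}.
Local Notation chain3 := {ffun gT * gT * gT -> int}.

Definition bar3 (g h k : gT) : chain3 := [ffun x => (x == (g, h, k))%:Z].

Lemma boundary3_bar3 g h k :
  boundary3 (bar3 g h k)
    = bar2 h k - bar2 (g * h)%g k + bar2 g (h * k)%g - bar2 g h.
Proof.
rewrite /boundary3 (bigD1 (g, h, k)) //= ffunE eqxx big1 ?addr0 //.
by move=> [[g' h'] k'] ne; rewrite ffunE (negbTE ne).
Qed.

Lemma chain2E (c : chain2) : c = \sum_x bar2 x.1 x.2 *~ c x.
Proof.
apply/ffunP=> y; rewrite sum_ffunE (bigD1 y) //= big1 ?addr0.
  by rewrite ffunMzE ffunE -surjective_pairing eqxx mulrzz mul1r.
move=> x; rewrite eq_sym => ne.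
by rewrite ffunMzE ffunE -surjective_pairing (negbTE ne) mul0rz.
Qed.

(** Chains of degree 1 are the free abelian group on gT; this is the homomorphism
    that maps [g] to phi g. *)
Definition chain1_linear (V : zmodType) (phi : gT -> V) (b : chain1) : V :=
  \sum_g phi g *~ b g.

Lemma chain1_linear_is_zmod_morphism (V : zmodType) (phi : gT -> V) :
  zmod_morphism (chain1_linear phi).
Proof.
move=> a b; rewrite /chain1_linear -sumrB; apply: eq_bigr => g _.
by rewrite !ffunE mulrzBr.
Qed.
HB.instance Definition _ (V : zmodType) (phi : gT -> V) :=
  GRing.isZmodMorphism.Build chain1 V (chain1_linear phi)
    (chain1_linear_is_zmod_morphism phi).

Lemma chain1_linear_bar1 (V : zmodType) (phi : gT -> V) g :
  chain1_linear phi (bar1 g) = phi g.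
Proof.
rewrite /chain1_linear (bigD1 g) //= ffunE eqxx mulr1z big1 ?addr0 // => h ne.
by rewrite ffunE (negbTE ne).
Qed.

Lemma chain1_linear_boundary2 (V : zmodType) (phi : gT -> V) (c : chain2) :
  chain1_linear phi (boundary2 c)
    = \sum_x (phi x.2 - phi (x.1 * x.2)%g + phi x.1) *~ c x.
Proof.
rewrite /boundary2 raddf_sum; apply: eq_bigr => -[g h] _ /=.
by rewrite raddfMz raddfD raddfB /= !chain1_linear_bar1.
Qed.

(** The order of the group annihilates its second homology.  Sum the boundary of
    [g|h|k] over k: with S(g) the sum of all [g|k], the result is
    S(h) - S(gh) + S(g) - |G| [g|h], and the S-terms are the image of the boundary
    of [g|h] under a homomorphism. *)
Lemma card_cycle2_boundary (c : chain2) :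
  boundary2 c = 0 -> exists d, boundary3 d = c *+ #|gT|.
Proof.
move=> c0; pose d x := \sum_k bar3 x.1 x.2 k *~ c x; exists (- \sum_x d x).
have -> : boundary3 (- \sum_x d x) = - \sum_x boundary3 (d x).
  by rewrite (raddfN (@boundary3 gT)) (raddf_sum (@boundary3 gT)).
apply/esym/eqP; rewrite -addr_eq0 {1}[c]chain2E -sumrMnl -big_split /=.
have E0 : chain1_linear (fun g => \sum_k bar2 g k) (boundary2 c) = 0.
  by rewrite c0 raddf0.
rewrite -[X in _ == X]E0 chain1_linear_boundary2.
apply/eqP/eq_bigr=> -[g h] _ /=.
rewrite (raddf_sum (@boundary3 gT)) /=.
under eq_bigr => k _ do rewrite raddfMz /= boundary3_bar3.
rewrite -mulrz_suml pmulrn mulrzAC -pmulrn -mulrzDl; congr (_ *~ _).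
rewrite !sumrB big_split /= sumrB sumr_const.
rewrite addrCA subrr addr0; congr (_ + _).
by rewrite [RHS](reindex_inj (mulgI h)).
Qed.
End Chains.

Section CyclesAreCommutators.
Variables (gT : finGroupType) (D : finZmodType) (f : gT -> gT -> D).
Hypothesis fP : cocycle2 f.
Local Notation ext := (cocycle_ext fP).
Local Notation E' := ([set: ext]^`(1))%g.

Lemma coset_der1_commute (x y : coset_of E') : commute x y.
Proof.
have [u _ ->] := cosetP x; have [v _ ->] := cosetP y.
have abE : abelian ([set: ext] / E')%g := der_abelian 0 [set: ext].
have inQ z : coset E' z \in ([set: ext] / E')%g.
  by rewrite mem_quotient ?inE.
exact: (centsP abE).
Qed.

Local Notation Q := (additive_view coset_der1_commute).

Definition to_abelianization (x : ext) : Q := coset E' x.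

Let norm_der1 (x : ext) : x \in 'N(E')%g.
Proof. by apply: (fintype.subsetP (der_norm 1 [set: ext]%G)); rewrite inE. Qed.

Lemma to_abelianizationM (x y : ext) :
  to_abelianization (x * y)%g = to_abelianization x + to_abelianization y.
Proof. exact: morphM. Qed.

Definition coef_to_abelianization (d : D) : Q := to_abelianization (ext_in fP d).

Lemma coef_to_abelianizationD a b :
  coef_to_abelianization (a + b)
    = coef_to_abelianization a + coef_to_abelianization b.
Proof. by rewrite -to_abelianizationM -ext_inD. Qed.

Lemma coef_to_abelianization_is_zmod_morphism :
  zmod_morphism coef_to_abelianization.
Proof.
move=> a b; apply: (addIr (coef_to_abelianization b)).
by rewrite -coef_to_abelianizationD !subrK.
Qed.
HB.instance Definition _ := GRing.isZmodMorphism.Build D Q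
  coef_to_abelianization coef_to_abelianization_is_zmod_morphism.

Lemma coef_to_abelianization_cocycle g h :
  coef_to_abelianization (f g h)
    = to_abelianization (ext_lift fP h)
      - to_abelianization (ext_lift fP (g * h)%g)
      + to_abelianization (ext_lift fP g).
Proof.
rewrite addrAC [X in X - _]addrC -to_abelianizationM ext_lift_mul.
by rewrite to_abelianizationM addrK.
Qed.

(** In the abelianization of the extension, f g h becomes the value at the
    boundary of [g|h] of the homomorphism that sends [g] to the lift of g.  Hence
    pi c becomes the value of that homomorphism at the boundary of c. *)
Lemma cycle2_in_der1 (pi : {additive {ffun gT * gT -> int} -> D}) c :
    (forall g h, pi (bar2 g h) = f g h) -> boundary2 c = 0 ->
  ext_in fP (pi c) \in E'.
Proof.
move=> piE c0; apply: coset_idr; first exact: norm_der1.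
have /= :=
  chain1_linear_boundary2 (fun g => to_abelianization (ext_lift fP g)) c.
rewrite c0 raddf0 => /esym E0.
rewrite -[LHS]/(coef_to_abelianization (pi c)) [c]chain2E !raddf_sum /=.
apply: etrans E0; apply: eq_bigr => -[g h] _ /=.
by rewrite !raddfMz /= piE coef_to_abelianization_cocycle.
Qed.

End CyclesAreCommutators.

Section BarCocycle.
Variable gT : finGroupType.
Local Notation chain2 := {ffun gT * gT -> int}.
Local Notation s := #|gT|.

(** Adding the multiples of |G| to the boundaries makes the quotient finite,
    without identifying inequivalent cycles. *)
Definition boundary2_mod : {pred chain2} :=
  [pred c | `[< exists d e, c = boundary3 d + e *+ s >]].

Lemma boundary2_mod_zmod_closed : zmod_closed boundary2_mod.
Proof.
split=> [|a b].
  by apply/asboolP; exists 0, 0; rewrite raddf0 mul0rn addr0.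
move=> /asboolP[d [e ->]] /asboolP[d' [e' ->]]; apply/asboolP.
by exists (d - d'), (e - e'); rewrite raddfB mulrnBl /= addrACA opprD.
Qed.
HB.instance Definition _ :=
  GRing.isZmodClosed.Build chain2 boundary2_mod boundary2_mod_zmod_closed.

Definition bar_coef := Quotient.quot boundary2_mod.
HB.instance Definition _ := GRing.Zmodule.on bar_coef.

Definition bar_class (c : chain2) : bar_coef := \pi_(bar_coef) c.

Lemma bar_class_is_zmod_morphism : zmod_morphism bar_class.
Proof. by move=> a b; rewrite /bar_class raddfB. Qed.
HB.instance Definition _ :=
  GRing.isZmodMorphism.Build chain2 bar_coef bar_class bar_class_is_zmod_morphism.

Lemma bar_class_eq a b : bar_class a = bar_class b <-> a - b \in boundary2_mod.
Proof. by rewrite Quotient.idealrBE; split=> [/eqP|/eqP]. Qed.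

Let s_gt0 : (0 < s)%N. Proof. exact/card_gt0P/(ex_intro _ 1%g). Qed.

(** An element of the quotient is determined by the residues modulo |G| of the
    coefficients of any representative. *)
Definition bar_residues (q : bar_coef) : {ffun gT * gT -> 'I_s.-1.+1} :=
  [ffun x => inord `|(generic_quotient.repr q x %% s)%Z|].
Definition of_bar_residues (t : {ffun gT * gT -> 'I_s.-1.+1}) : bar_coef :=
  bar_class [ffun x => (t x : nat)%:Z].

Lemma bar_residuesK : cancel bar_residues of_bar_residues.
Proof.
move=> q; rewrite -[RHS]reprK; apply/bar_class_eq/asboolP.
exists 0, [ffun x => - (generic_quotient.repr q x %/ s)%Z].
rewrite raddf0 add0r.
apply/ffunP=> x; rewrite !ffunE ffunMnE ffunE.
have s_neq0 : s%:Z != 0 by rewrite eqz_nat -lt0n.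
set z := generic_quotient.repr q x.
rewrite inordK; last first.
  by rewrite prednK // -ltz_nat gez0_abs ?modz_ge0 ?ltz_pmod.
rewrite gez0_abs ?modz_ge0 // {2}(divz_eq z s) mulNrn -mulr_natr natz.
by rewrite opprD addrCA subrr addr0.
Qed.

HB.instance Definition _ : isCountable bar_coef := CanIsCountable bar_residuesK.
HB.instance Definition _ : isFinite bar_coef := CanIsFinite bar_residuesK.

Definition bar_cocycle (g h : gT) : bar_coef := bar_class (bar2 g h).

Lemma bar_cocycleP : cocycle2 bar_cocycle.
Proof.
move=> g h k; rewrite -!(raddfB, raddfD) -boundary3_bar3.
rewrite -[RHS](raddf0 bar_class); apply/bar_class_eq/asboolP.
by exists (bar3 g h k), 0; rewrite mul0rn addr0 subr0.
Qed.

(** If a - b is a boundary plus |G| e, then |G| e is a cycle, hence so is e since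
    chains are torsion-free; and |G| e is then a boundary. *)
Lemma bar_class_cycle_inj (a b : cycle2 gT) :
  bar_class a = bar_class b -> a - b \in @is_boundary2 gT.
Proof.
move=> /bar_class_eq/asboolP[d [e abE]].
have cyc (z : cycle2 gT) : boundary2 z = 0 by apply/eqP; case: z.
have e0 : boundary2 e = 0.
  have := congr1 (@boundary2 gT) abE.
  rewrite raddfB raddfD /= !cyc subrr boundary23 add0r raddfMn /= => /esym/eqP.
  move=> /eqP/ffunP es0; apply/ffunP=> g; have := es0 g.
  rewrite ffunMnE !ffunE => /eqP; rewrite mulrn_eq0 => /orP[|/eqP//].
  by rewrite eqn0Ngt s_gt0.
have [d' d'E] := card_cycle2_boundary e0.
by apply/asboolP; exists (d + d'); rewrite raddfD /= d'E -abE.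
Qed.

Local Notation bar_ext := (cocycle_ext bar_cocycleP).
Local Notation A :=
  ('ker (ext_proj (fP := bar_cocycleP)) :&: [set: bar_ext]^`(1))%g.

Lemma card_homology2_le : ([set: homology2 gT]%classic #<= `I_#|A|)%card.
Proof.
pose phi (q : homology2 gT) : bar_ext :=
  ext_in bar_cocycleP (bar_class (generic_quotient.repr q : cycle2 gT)).
have phiA q : phi q \in A.
  rewrite finset.in_setI ext_in_ker; apply: cycle2_in_der1 => //.
  by apply/eqP; case: (generic_quotient.repr q).
have phi_inj : injective phi.
  move=> q q' /ext_in_inj/bar_class_cycle_inj; rewrite Quotient.idealrBE.
  by rewrite !reprK => /eqP.
pose h q := index (phi q) (enum A).
have h_lt q : (h q < #|A|)%N by rewrite cardE index_mem mem_enum.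
apply/pcard_leP/injfunPex; exists h; first by move=> q _; apply: h_lt.
move=> q q' _ _ eqh; apply: phi_inj.
rewrite -(nth_index 1%g (s := enum A) (x := phi q)) ?mem_enum // -/(h q) eqh.
by rewrite nth_index ?mem_enum.
Qed.
End BarCocycle.

End Homology.

Theorem corollary4p8 (p : nat) (gT : finGroupType) (G : {group gT}) (r k : nat)
    (p_prime : prime p) (p_neq2 : p <> 2) (p_neq3 : p <> 3)
    (pG : (p.-group G)%g)
    (coclassG : coclass p G = r)
    (classG : (2 < nil_class G)%N)
    (card_derG : #|G^`(1)%g| = (p ^ k)%N) :
  ([set: schur_multiplier G]%classic
     #<= `I_(p ^ ((r ^ 2 - r) %/ 2 + k * r))%classic)%card.
Proof.
apply: card_le_trans (card_homology2_le _) _; rewrite card_le_II.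
set fP := @bar_cocycleP _.
have isoG : ([set: cocycle_ext fP] / 'ker (ext_proj (fP := fP)) \isog G)%g.
  by apply: isog_trans (ext_quotient_isog fP) _; rewrite isog_sym isog_subg.
have -> : ((r ^ 2 - r) %/ 2 = 'C(r, 2))%N.
  by rewrite bin2 divn2 -mulnn -subn1 mulnBr muln1.
apply: central_extension_bound => //.
- exact: ker_ext_proj_central.
- by rewrite /pgroup (card_isog isoG).
- by rewrite (isog_nil_class isoG).
- by rewrite (isog_nil_class isoG) (card_isog isoG).
- by rewrite -card_derG; apply: card_isog; apply: isog_der.
Qed.
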